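(* Let $\Omega$ be a compact Hausdorff space and let $\mathcal{A}$ be a unital $C^*$-algebra that has a faithful tracial state $\tau$. If $f$ is a $C^*$-extreme point of the closed unit ball of the $C^*$-algebra $C(\Omega,\mathcal{A})$, then $f$ is a unitary of $C(\Omega,\mathcal{A})$.
   Context: For a compact Hausdorff space $\Omega$ and a unital $C^*$-algebra $\mathcal{A}$, $C(\Omega,\mathcal{A})$ denotes the unital $C^*$-algebra of all norm-continuous functions $\Omega\to\mathcal{A}$ with pointwise operations and supremum norm. For a unital $C^*$-algebra $\mathcal{B}$ with identity $\mathbf{1}_{\mathcal{B}}$, let $\mathcal{B}_1$ be its closed unit ball. An element $x\in\mathcal{B}_1$ is a $C^*$-extreme point of $\mathcal{B}_1$ if whenever $x=\sum_{i=1}^k t_i^*x_it_i$ with $x_1,\dots,x_k\in\mathcal{B}_1$ and invertible $t_1,\dots,t_k\in\mathcal{B}$ satisfying $\sum_{i=1}^k t_i^*t_i=\mathbf{1}_{\mathcal{B}}$, there exist unitaries $u_1,\dots,u_k\in\mathcal{B}$ with $x_i=u_i^*xu_i$ for $i=1,\dots,k$. A tracial state is a state $\tau$ with $\tau(ab)=\tau(ba)$ for all $a,b$; it is faithful if $\tau(a^*a)=0$ implies $a=0$. *)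

(* Defs.v *)
From HB Require Import structures.
From mathcomp Require Import all_boot all_order all_algebra complex.
From mathcomp Require Import all_classical all_reals all_analysis.

Set Implicit Arguments.
Unset Strict Implicit.
Unset Printing Implicit Defensive.

Import Order.TTheory GRing.Theory Num.Theory.
Import numFieldNormedType.Exports.

Local Open Scope classical_set_scope.
Local Open Scope ring_scope.
Local Open Scope complex_scope.

(* Multiplication and unit are fields of the mixin, and the ring structure is
   put on the sort of cstarAlgType afterwards: Num.NumDomain already inherits
   from rings and from normed Z-modules, so HB rejects any later structure
   joining a ring with a norm valued in another field.  The ring is a
   pzRingType (1 = 0 is allowed) because C(Omega, A) is the zero algebra when
   Omega is empty. *)
HB.mixin Record isCStarAlgebra (R : realType) A
    & CompleteNormedModule R[i] A := {
  cone : A;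
  cmul : A -> A -> A;
  star : A -> A;
  cmulA : associative cmul;
  cmul1r : left_id cone cmul;
  cmulr1 : right_id cone cmul;
  cmulDl : left_distributive cmul +%R;
  cmulDr : right_distributive cmul +%R;
  scaler_cmull : forall (a : R[i]) (x y : A), a *: cmul x y = cmul (a *: x) y;
  scaler_cmulr : forall (a : R[i]) (x y : A), a *: cmul x y = cmul x (a *: y);
  normr_cmul : forall x y : A, `|cmul x y| <= `|x| * `|y|;
  starK : involutive star;
  starD : forall x y : A, star (x + y) = star x + star y;
  starZ : forall (a : R[i]) (x : A), star (a *: x) = (a^*)%R *: star x;
  star_cmul : forall x y : A, star (cmul x y) = cmul (star y) (star x);
  norm_star_cmul : forall x : A, `|cmul (star x) x| = `|x| ^+ 2
}.

#[short(type="cstarAlgType")]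
HB.structure Definition CStarAlgebra (R : realType) :=
  {A of CompleteNormedModule R[i] A & isCStarAlgebra R A}.

#[non_forgetful_inheritance]
HB.instance Definition _ (R : realType) (A : cstarAlgType R) :=
  GRing.Zmodule_isPzRing.Build (CStarAlgebra.sort A)
    cmulA cmul1r cmulr1 cmulDl cmulDr.

Section CStarAlgebraTheory.
Context {R : realType} {A : cstarAlgType R}.
Implicit Types x y : A.

Lemma cstar_scalerAl (a : R[i]) x y : a *: (x * y) = (a *: x) * y.
Proof. exact: scaler_cmull. Qed.

Lemma cstar_scalerAr (a : R[i]) x y : a *: (x * y) = x * (a *: y).
Proof. exact: scaler_cmulr. Qed.

Lemma cstar_normrM x y : `|x * y| <= `|x| * `|y|.
Proof. exact: normr_cmul. Qed.

Lemma starM x y : star (x * y) = star y * star x.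
Proof. exact: star_cmul. Qed.

Lemma norm_starM x : `|star x * x| = `|x| ^+ 2.
Proof. exact: norm_star_cmul. Qed.

Lemma starB x y : star (x - y) = star x - star y.
Proof. by rewrite -(scaleN1r y) starD starZ rmorphN rmorph1 scaleN1r. Qed.

Lemma norm_star x : `|star x| = `|x|.
Proof.
suff le (z : A) : `|z| <= `|star z|.
  by apply/eqP; rewrite eq_le le andbT -{2}(starK x) le.
have [->//|z0] := eqVneq `|z| 0.
have zp : 0 < `|z| by rewrite lt_def z0 normr_ge0.
by rewrite -(ler_pM2r zp) -expr2 -norm_starM cstar_normrM.
Qed.

Lemma star_continuous : continuous (star : A -> A).
Proof.
move=> x; apply/cvgrPdist_lt => e e0; near=> y.
rewrite -starB norm_star; near: y.
by apply: cvgr_dist_lt.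
Unshelve. all: by end_near. Qed.

Lemma cstar_mul_continuous (T : topologicalType) (f g : T -> A) :
  continuous f -> continuous g -> continuous (fun t => f t * g t).
Proof.
move=> cf cg t; apply/cvgrPdist_lt => e e0.
pose M := `|f t| + `|g t| + 1.
have M0 : 0 < M by apply: ltr_wpDl => //; exact: addr_ge0.
have d0 : 0 < e / (M + M) by apply: divr_gt0 => //; exact: addr_gt0.
near=> u.
have fu : `|f t - f u| < e / (M + M).
  by near: u; apply: cvgr_dist_lt => //; exact: cf.
have gu : `|g t - g u| < e / (M + M).
  by near: u; apply: cvgr_dist_lt => //; exact: cg.
have gu1 : `|g t - g u| < 1.
  by near: u; apply: cvgr_dist_lt => //; exact: cg.
have guM : `|g u| <= M.
  rewrite -(subKr (g t) (g u)) (le_trans (ler_normB _ _))//.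
  by rewrite /M -addrA ler_wpDl// lerD2l ltW.
have ftM : `|f t| <= M by rewrite /M -addrA lerDl addr_ge0.
have -> : f t * g t - f u * g u = f t * (g t - g u) + (f t - f u) * g u.
  by rewrite mulrBr mulrBl addrA subrK.
rewrite (le_lt_trans (ler_normD _ _))//.
have -> : e = M * (e / (M + M)) + (e / (M + M)) * M.
  rewrite [X in X + _]mulrC -mulrDr mulfVK//.
  by rewrite gt_eqF// addr_gt0.
rewrite ltr_leD//.
- rewrite (le_lt_trans (cstar_normrM _ _))//.
  rewrite (@le_lt_trans _ _ (M * `|g t - g u|))//.
    by rewrite ler_wpM2r.
  by rewrite ltr_pM2l.
- rewrite (le_trans (cstar_normrM _ _))//.
  by rewrite ler_pM// ltW.
Unshelve. all: by end_near. Qed.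

End CStarAlgebraTheory.

(* C(Omega, A).  The compactness proof is a parameter of the type because the
   supremum norm, and hence the C*-algebra structure below, depends on it. *)
Record cfun (R : realType) (Omega : topologicalType)
    (cOmega : compact [set: Omega]) (A : cstarAlgType R) := CFun {
  cfun_val :> Omega -> A;
  cfun_cts : continuous cfun_val
}.

HB.instance Definition _ (R : realType) (Omega : topologicalType)
  (cOmega : compact [set: Omega]) (A : cstarAlgType R) :=
  gen_eqMixin (cfun cOmega A).
HB.instance Definition _ (R : realType) (Omega : topologicalType)
  (cOmega : compact [set: Omega]) (A : cstarAlgType R) :=
  gen_choiceMixin (cfun cOmega A).

Section ContinuousFunctions.
Context {R : realType} {Omega : topologicalType}.
Context {cOmega : compact [set: Omega]} {A : cstarAlgType R}.
Local Notation C := (cfun cOmega A).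
Implicit Types f g h : C.

Lemma cfunP f g : (forall w, f w = g w) -> f = g.
Proof.
case: f g => [f cf] [g cg] /= /funext fg.
by move: cf; rewrite fg => cf; congr CFun; exact: Prop_irrelevance.
Qed.

Lemma cfun_cst_cts (a : A) : continuous (fun _ : Omega => a).
Proof. by move=> w; exact: cvg_cst. Qed.

Lemma cfun_opp_cts f : continuous (fun w => - f w).
Proof. by move=> w; apply: cvgN; exact: cfun_cts. Qed.

Lemma cfun_add_cts f g : continuous (fun w => f w + g w).
Proof. by move=> w; apply: cvgD; exact: cfun_cts. Qed.

Lemma cfun_scale_cts (a : R[i]) f : continuous (fun w => a *: f w).
Proof. by move=> w; apply: cvgZr; exact: cfun_cts. Qed.

Lemma cfun_mul_cts f g : continuous (fun w => f w * g w).
Proof. by apply: cstar_mul_continuous; exact: cfun_cts. Qed.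

Lemma cfun_star_cts f : continuous (fun w => star (f w)).
Proof.
move=> w; apply: continuous_comp; first exact: cfun_cts.
exact: star_continuous.
Qed.

Definition cfun_cst (a : A) : C := CFun cOmega (@cfun_cst_cts a).
Definition cfun_opp f : C := CFun cOmega (@cfun_opp_cts f).
Definition cfun_add f g : C := CFun cOmega (@cfun_add_cts f g).
Definition cfun_scale (a : R[i]) f : C := CFun cOmega (@cfun_scale_cts a f).
Definition cfun_mul f g : C := CFun cOmega (@cfun_mul_cts f g).
Definition cfun_star f : C := CFun cOmega (@cfun_star_cts f).

Lemma cfun_addA : associative cfun_add.
Proof. by move=> f g h; apply: cfunP => w; exact: addrA. Qed.

Lemma cfun_addC : commutative cfun_add.
Proof. by move=> f g; apply: cfunP => w; exact: addrC. Qed.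

Lemma cfun_add0 : left_id (cfun_cst 0) cfun_add.
Proof. by move=> f; apply: cfunP => w; exact: add0r. Qed.

Lemma cfun_addN : left_inverse (cfun_cst 0) cfun_opp cfun_add.
Proof. by move=> f; apply: cfunP => w; exact: addNr. Qed.

HB.instance Definition _ := GRing.isZmodule.Build C
  cfun_addA cfun_addC cfun_add0 cfun_addN.

Lemma cfun_scaleA : forall (a b : R[i]) f,
  cfun_scale a (cfun_scale b f) = cfun_scale (a * b) f.
Proof. by move=> a b f; apply: cfunP => w; exact: scalerA. Qed.

Lemma cfun_scale1 : left_id 1 cfun_scale.
Proof. by move=> f; apply: cfunP => w; exact: scale1r. Qed.

Lemma cfun_scaleDr : right_distributive cfun_scale +%R.
Proof. by move=> a f g; apply: cfunP => w; exact: scalerDr. Qed.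

Lemma cfun_scaleDl : forall f, {morph cfun_scale^~ f : a b / a + b}.
Proof. by move=> f a b; apply: cfunP => w; exact: scalerDl. Qed.

HB.instance Definition _ := GRing.Zmodule_isLmodule.Build R[i] C
  cfun_scaleA cfun_scale1 cfun_scaleDr cfun_scaleDl.

(* Norms over R[i] are R[i]-valued; the supremum is taken in R.  For empty
   Omega it is sup set0 = 0. *)
Definition cfun_norm f : R[i] :=
  (sup [set complex.Re `|f w| | w in [set: Omega]])%:C.

Lemma ReK_norm (a : A) : (complex.Re `|a|)%:C = `|a|.
Proof. by rewrite RRe_real// ger0_real. Qed.

Lemma cfun_has_ubound f :
  has_ubound [set complex.Re `|f w| | w in [set: Omega]].
Proof.
have cn : continuous (fun w => complex.Re `|f w|).
  move=> w; apply/cvgrPdist_lt => e e0; near=> v.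
  rewrite -ltcR (le_lt_trans (_ : _ <= `|f w - f v|))//.
    rewrite -raddfB; apply: le_trans (normc_ge_Re _) _.
    exact: ler_dist_dist.
  by near: v; apply: cvgr_dist_lt; [exact: cfun_cts|rewrite ltcR].
have /compact_bounded[M [_ MM]] :
    compact ((fun w => complex.Re `|f w|) @` [set: Omega]).
  by apply: continuous_compact => //; exact: continuous_subspaceT.
exists (M + 1) => _ [w _ <-].
apply: le_trans (ler_norm _) _; apply: MM; first by rewrite ltrDl.
by exists w.
Unshelve. all: by end_near. Qed.

Lemma cfun_norm_ub f w : `|f w| <= cfun_norm f.
Proof.
by rewrite -ReK_norm lecR; apply: (ub_le_sup (cfun_has_ubound f)); exists w.
Qed.

Lemma cfun_norm_le f (M : R[i]) :
  0 <= M -> (forall w, `|f w| <= M) -> cfun_norm f <= M.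
Proof.
move=> M0 fM; have MR : (complex.Re M)%:C = M by rewrite RRe_real// ger0_real.
rewrite -MR lecR.
have [S0|/set0P S0] := eqVneq [set complex.Re `|f w| | w in [set: Omega]] set0.
  by rewrite S0 sup0 -ler0c MR.
by apply: ge_sup => // _ [w _ <-]; rewrite -lecR ReK_norm MR.
Qed.

Lemma cfun_norm_ge0 f : 0 <= cfun_norm f.
Proof.
rewrite ler0c; have [S0|/set0P[x Sx]] :=
  eqVneq [set complex.Re `|f w| | w in [set: Omega]] set0.
  by rewrite S0 sup0.
apply: le_trans (ub_le_sup (cfun_has_ubound f) Sx).
by case: Sx => w _ <-; rewrite -ler0c ReK_norm.
Qed.

Lemma cfun_normD f g : cfun_norm (f + g) <= cfun_norm f + cfun_norm g.
Proof.
apply: cfun_norm_le => [|w]; first by rewrite addr_ge0 ?cfun_norm_ge0.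
by rewrite (le_trans (ler_normD _ _))// lerD ?cfun_norm_ub.
Qed.

Lemma cfun_normZ_le (a : R[i]) f : cfun_norm (a *: f) <= `|a| * cfun_norm f.
Proof.
apply: cfun_norm_le => [|w]; first by rewrite mulr_ge0 ?cfun_norm_ge0.
by rewrite normrZ ler_wpM2l ?cfun_norm_ub.
Qed.

Lemma cfun_normZ (a : R[i]) f : cfun_norm (a *: f) = `|a| * cfun_norm f.
Proof.
apply/eqP; rewrite eq_le cfun_normZ_le/=.
have [->|a0] := eqVneq a 0; first by rewrite normr0 mul0r cfun_norm_ge0.
rewrite -ler_pdivlMl ?normr_gt0// -normfV.
by rewrite -{1}(scale1r f) -(mulVf a0) -scalerA cfun_normZ_le.
Qed.

Lemma cfun_norm_eq0 f : cfun_norm f = 0 -> f = 0.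
Proof.
move=> f0; apply: cfunP => w; apply/eqP; rewrite -normr_le0 -f0.
exact: cfun_norm_ub.
Qed.

HB.instance Definition _ := Lmodule_isNormed.Build R[i] C
  cfun_normD cfun_normZ cfun_norm_eq0.

Lemma cfun_normE f :
  `|f| = (sup [set complex.Re `|f w| | w in [set: Omega]])%:C.
Proof. by []. Qed.

Lemma cfun_cauchy_cvg (F : set_system C) : ProperFilter F -> cauchy F -> cvg F.
Proof.
move=> FF /cauchy_ballP Fc.
have Fc' (e : R[i]) : 0 < e ->
    \forall f & g \near F,
    forall w : Omega, `|(f : C) w - (g : C) w| < e.
  move=> e0; apply: filterS (Fc e e0) => -[f g] /=; rewrite -ball_normE/= => fg w.
  exact: le_lt_trans (cfun_norm_ub (f - g) w) fg.
have cvx (w : Omega) : cvg ((fun f : C => f w) @ F).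
  apply: cauchy_cvg; apply/cauchy_ballP => e e0.
  rewrite !near_simpl near_map2.
  by apply: filterS (Fc' e e0) => -[f g] /= /(_ w); rewrite -ball_normE.
pose l w := lim ((fun f : C => f w) @ F).
have Fl (e : R[i]) : 0 < e -> \forall f \near F, forall w, `|l w - (f : C) w| <= e.
  move=> e0; have e20 : 0 < e / 2 by rewrite divr_gt0.
  near=> f => w; near F => g.
  rewrite -(subrKA (g w)) (le_trans (ler_normD _ _))// [leRHS](splitr e) lerD//.
    apply: ltW; near: g; apply: cvgr_dist_lt => //; exact: cvx.
  rewrite distrC ltW//; move: (w); near: g; near: f.
  by apply: nearP_dep; exact: Fc'.
have cl : continuous l.
  move=> w; apply/cvgrPdist_lt => e e0.
  have e40 : 0 < e / 2 / 2 by rewrite !divr_gt0.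
  near F => f; near=> v.
  have lf : forall u, `|l u - f u| <= e / 2 / 2 by near: f; exact: Fl.
  rewrite -(subrKA (f w)) (le_lt_trans (ler_normD _ _))// [ltRHS](splitr e).
  rewrite ler_ltD//.
    rewrite (le_trans (lf w))// ler_piMr ?invf_le1 ?ler1n//.
    by rewrite ltW// divr_gt0.
  rewrite -(subrKA (f v)) (le_lt_trans (ler_normD _ _))// [ltRHS](splitr (e / 2)).
  rewrite ltr_leD// ?(distrC (f v)) ?lf//.
  by near: v; apply: cvgr_dist_lt => //; exact: cfun_cts.
apply/cvg_ex; exists (CFun cOmega cl).
apply/cvgrPdist_le => e e0.
apply: filterS (Fl _ e0) => f lf.
by apply: cfun_norm_le => //; exact: ltW.
Unshelve. all: by end_near. Qed.

HB.instance Definition _ := Uniform_isComplete.Build C cfun_cauchy_cvg.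

Lemma cfun_normM f g : `|cfun_mul f g| <= `|f| * `|g|.
Proof.
apply: cfun_norm_le => [|w]; first by rewrite mulr_ge0.
by rewrite (le_trans (cstar_normrM _ _))// ler_pM ?cfun_norm_ub.
Qed.

Lemma cfun_norm_starM f : `|cfun_mul (cfun_star f) f| = `|f| ^+ 2.
Proof.
have sf w : `|f w| ^+ 2 <= `|cfun_mul (cfun_star f) f|.
  rewrite -norm_starM.
  exact: (cfun_norm_ub (cfun_mul (cfun_star f) f) w).
apply/eqP; rewrite eq_le; apply/andP; split.
  apply: cfun_norm_le => [|w]; first by rewrite exprn_ge0.
  have -> : (cfun_mul (cfun_star f) f) w = star (f w) * f w by [].
  by rewrite norm_starM lerXn2r ?nnegrE ?cfun_norm_ub// normr_ge0.
rewrite -[leRHS]sqrtCK lerXn2r ?nnegrE ?sqrtC_ge0//.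
apply: cfun_norm_le => [|w]; first by rewrite sqrtC_ge0.
by rewrite -(@ler_pXn2r _ 2) ?nnegrE ?sqrtC_ge0// sqrtCK.
Qed.

Lemma cfun_mulA : associative cfun_mul.
Proof. by move=> f g h; apply: cfunP => w; exact: mulrA. Qed.

Lemma cfun_mul1f : left_id (cfun_cst 1) cfun_mul.
Proof. by move=> f; apply: cfunP => w; exact: mul1r. Qed.

Lemma cfun_mulf1 : right_id (cfun_cst 1) cfun_mul.
Proof. by move=> f; apply: cfunP => w; exact: mulr1. Qed.

Lemma cfun_mulDl : left_distributive cfun_mul +%R.
Proof. by move=> f g h; apply: cfunP => w; exact: mulrDl. Qed.

Lemma cfun_mulDr : right_distributive cfun_mul +%R.
Proof. by move=> f g h; apply: cfunP => w; exact: mulrDr. Qed.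

Lemma cfun_scaler_mull : forall (a : R[i]) f g,
  a *: cfun_mul f g = cfun_mul (a *: f) g.
Proof. by move=> a f g; apply: cfunP => w; exact: cstar_scalerAl. Qed.

Lemma cfun_scaler_mulr : forall (a : R[i]) f g,
  a *: cfun_mul f g = cfun_mul f (a *: g).
Proof. by move=> a f g; apply: cfunP => w; exact: cstar_scalerAr. Qed.

Lemma cfun_starK : involutive cfun_star.
Proof. by move=> f; apply: cfunP => w; exact: starK. Qed.

Lemma cfun_starD : forall f g, cfun_star (f + g) = cfun_star f + cfun_star g.
Proof. by move=> f g; apply: cfunP => w; exact: starD. Qed.

Lemma cfun_starZ : forall (a : R[i]) f,
  cfun_star (a *: f) = (a^*)%R *: cfun_star f.
Proof. by move=> a f; apply: cfunP => w; exact: starZ. Qed.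

Lemma cfun_starM : forall f g,
  cfun_star (cfun_mul f g) = cfun_mul (cfun_star g) (cfun_star f).
Proof. by move=> f g; apply: cfunP => w; exact: starM. Qed.

HB.instance Definition _ := isCStarAlgebra.Build R C
  cfun_mulA cfun_mul1f cfun_mulf1 cfun_mulDl cfun_mulDr
  cfun_scaler_mull cfun_scaler_mulr cfun_normM
  cfun_starK cfun_starD cfun_starZ cfun_starM cfun_norm_starM.

HB.instance Definition _ := GRing.PzRing.copy C (C : cstarAlgType R).

End ContinuousFunctions.

Section Notions.
Context {R : realType} {B : cstarAlgType R}.
Implicit Types x y u t : B.

Definition cstar_unitary u := star u * u = 1 /\ u * star u = 1.

Definition cstar_invertible t := exists s : B, s * t = 1 /\ t * s = 1.

Definition closed_unit_ball : set B := [set x | `|x| <= 1].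

Definition cstar_extreme_point x :=
  closed_unit_ball x /\
  forall (k : nat) (y t : 'I_k -> B),
    (forall i, closed_unit_ball (y i)) ->
    (forall i, cstar_invertible (t i)) ->
    \sum_(i < k) star (t i) * t i = 1 ->
    x = \sum_(i < k) star (t i) * y i * t i ->
    exists u : 'I_k -> B,
      forall i, cstar_unitary (u i) /\ y i = star (u i) * x * u i.

(* The order on R[i] makes 0 <= z assert that z is real and nonnegative. *)
Definition cstar_state (tau : {scalar B}) :=
  (forall a : B, 0 <= tau (star a * a)) /\ tau 1 = 1.

Definition tracial_state (tau : {scalar B}) :=
  cstar_state tau /\ forall a b : B, tau (a * b) = tau (b * a).

Definition faithful_state (tau : {scalar B}) :=
  forall a : B, tau (star a * a) = 0 -> a = 0.

End Notions.

(* Main.v *)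
(* The traces [g |-> tau (g w)] separate C(Omega, A), so it suffices to work in
   a C*-algebra with a separating family of tracial states.  Conjugation by a
   unitary preserves the trace of [x^* x]; hence, by the parallelogram law, a
   C*-extreme point [x] is an extreme point of the unit ball.  As in Kadison's
   theorem, perturbing [x] by [x (1 - (x^* x)^2) / 4] and by
   [(1 - x x^* ) b (1 - x^* x)] shows that [x] is a partial isometry with
   defects [p = 1 - x x^*] and [q = 1 - x^* x] such that [p b q = 0] for all
   [b].  The elements [x^*^n q x^n] then all have the same trace as [q], while
   the partial sums [1 - x^*^n x^n] of their series have trace at most 1, so [q]
   has trace 0.  Hence [q = 0], and [p = 0] because it has the same trace. *)
From HB Require Import structures.
Require Import Defs.
From mathcomp Require Import all_boot all_order all_algebra complex.
From mathcomp Require Import all_classical all_reals all_analysis ring lra.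

Set Implicit Arguments.
Unset Strict Implicit.
Unset Printing Implicit Defensive.

Import Order.TTheory GRing.Theory Num.Theory.
Import numFieldNormedType.Exports.

Local Open Scope classical_set_scope.
Local Open Scope ring_scope.

(** With [v = t^2], the left side is [16^2] times 1 minus the square of [t (5 - t^2)^2 / 16]. Only
    one variable occurs, so [ring] proves the identity over the commutative [{poly int}] and
    evaluation at [v] carries it to [S]. The zero ring is set apart because the evaluation morphism
    lands in a nonzero ring. *)
Lemma quintic_factorization (S : pzRingType) (v : S) :
  16 ^+ 2 - v * (5 - v) ^+ 4 =
  (1 - v) ^+ 2 * (16 ^+ 2 - (v *+ 113 - v ^+ 2 *+ 18 + v ^+ 3)).
Proof.
have [S0|S0] := eqVneq (1 : S) 0.
  by rewrite -[LHS]mul1r -[RHS]mul1r S0 !mul0r.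
pose S' : nzRingType := HB.pack (S : Type) (GRing.PzRing.class S)
  (GRing.PzSemiRing_isNonZero.Build S S0).
have cv : commr_rmorph (intr : int -> S') v.
  by move=> z; exact: commr_int.
pose ev : {rmorphism {poly int} -> S'} := horner_morph cv.
have evX : ev 'X = v by exact: horner_morphX.
have evl k l : ev (k%:R ^+ 2 - 'X * (l%:R - 'X) ^+ 4) =
    k%:R ^+ 2 - (v : S') * (l%:R - v) ^+ 4.
  by rewrite !(rmorphB, rmorphM, rmorphXn, rmorph_nat, evX).
have evr k l m :
    ev ((1 - 'X) ^+ 2 * (k%:R ^+ 2 - ('X *+ l - 'X ^+ 2 *+ m + 'X ^+ 3))) =
    (1 - (v : S')) ^+ 2 * (k%:R ^+ 2 - (v *+ l - v ^+ 2 *+ m + v ^+ 3)).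
  by rewrite !(rmorphB, rmorphD, rmorphMn, rmorphM,
    rmorphXn, rmorph_nat, rmorph1, evX).
have : 16 ^+ 2 - 'X * (5 - 'X) ^+ 4 = (1 - 'X) ^+ 2 *
    (16 ^+ 2 - ('X *+ 113 - 'X ^+ 2 *+ 18 + 'X ^+ 3)) :> {poly int} by ring.
by move/(congr1 ev); rewrite evl evr.
Qed.

(** * Involution and norm estimates in a C*-algebra *)

Section CStarBasics.
Context {R : realType} {A : cstarAlgType R}.
Implicit Types (x y : A).

Lemma star0 : star 0 = 0 :> A.
Proof. by have := starB (0 : A) 0; rewrite !subrr. Qed.

Lemma star1 : star 1 = 1 :> A.
Proof. by rewrite -[LHS]mul1r -[X in X * _]starK -starM mul1r starK. Qed.

Lemma star_mulrn x n : star (x *+ n) = star x *+ n.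
Proof. by elim: n => [|n ih]; rewrite ?star0// !mulrS starD ih. Qed.

Lemma star_exp x n : star (x ^+ n) = star x ^+ n.
Proof. by elim: n => [|n ih]; rewrite ?star1// exprS starM ih -exprSr. Qed.

Lemma norm_le1_starM x : `|star x * x| <= 1 -> `|x| <= 1.
Proof. by rewrite norm_starM expr_le1. Qed.

Lemma norm_projection_le1 x : star x = x -> x * x = x -> `|x| <= 1.
Proof.
move=> sx xx; have [->//|x0] := eqVneq `|x| 0.
have : `|x| * `|x| = `|x| * 1 by rewrite -expr2 -norm_starM sx xx mulr1.
by move/(mulfI x0) => ->.
Qed.

(** Equality fails in the zero algebra, where [1 = 0]. *)
Lemma norm1_le1 : `|1 : A| <= 1.
Proof. by apply: norm_projection_le1; rewrite ?star1 ?mulr1. Qed.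

Lemma cstar_normM_le1 x y : `|x| <= 1 -> `|y| <= 1 -> `|x * y| <= 1.
Proof.
move=> x1 y1; apply: le_trans (cstar_normrM _ _) _.
by rewrite mulr_ile1.
Qed.

Lemma cstar_normX_le1 x n : `|x| <= 1 -> `|x ^+ n| <= 1.
Proof.
move=> x1; elim: n => [|n ih]; first exact: norm1_le1.
by rewrite exprS cstar_normM_le1.
Qed.

(* [g + i m] is unitary and [g] is its real part. *)
Lemma norm_cos_le1 (g m : A) : star g = g -> star m = m ->
  g * m = m * g -> g * g + m * m = 1 -> `|g| <= 1.
Proof.
move=> sg sm gm gm1; pose u := g + 'i *: m.
have su : star u = g - 'i *: m.
  by rewrite /u starD starZ sg sm conjCi scaleNr.
have u1 : `|u| <= 1.
  apply: norm_le1_starM; rewrite su.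
  suff -> : (g - 'i *: m) * u = 1 by exact: norm1_le1.
  have img : 'i *: m * g = 'i *: (g * m) by rewrite -cstar_scalerAl gm.
  have imm : 'i *: m * ('i *: m) = - (m * m).
    by rewrite -cstar_scalerAl -cstar_scalerAr scalerA -expr2 sqrCi scaleN1r.
  by rewrite mulrDr !mulrBl img imm -cstar_scalerAr opprK addrA subrK.
have -> : g = 2^-1 *: (u + star u).
  rewrite su /u addrACA subrr addr0 -[g + g]mulr2n -[g *+ 2]scaler_nat scalerA.
  by rewrite mulVf ?scale1r// pnatr_eq0.
rewrite normrZ ger0_norm ?invr_ge0// ler_pdivrMl// mulr1.
by rewrite (le_trans (ler_normD _ _))// norm_star (natrD _ 1 1) lerD.
Qed.

End CStarBasics.

(** * Square roots of [1 - h] for self-adjoint contractions [h] *)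

Section SquareRoot.
Context {R : realType} {A : cstarAlgType R}.
Implicit Types (h c : A).

Lemma cvgn_dominated (u : nat -> A) (rho : nat -> R) : cvgn rho ->
  (forall n m, (n <= m)%N -> `|u m - u n| <= (rho m - rho n)%:C%C) -> cvgn u.
Proof.
move=> crho urho; apply: cauchy_cvg; apply: cauchy_exP => e e0.
have [d d0 ->] : exists2 d : R, 0 < d & e = d%:C%C.
  exists (complex.Re e); last by rewrite RRe_real// gtr0_real.
  by rewrite -ltcR RRe_real// gtr0_real.
have d20 : 0 < d / 2 by rewrite divr_gt0.
have [N _ Nrho] := (cvgrPdist_lt _ _).1 crho _ d20.
exists (u N), N => // n /= Nn; rewrite -ball_normE/= distrC.
rewrite (le_lt_trans (urho _ _ Nn))// ltcR.
have := Nrho _ Nn; have := Nrho _ (leqnn N) => /=.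
by rewrite !ltr_norml => /andP[? ?] /andP[? ?]; lra.
Qed.

(* Picard iteration for [r = (h + r^2) / 2], the equation satisfied by
   [r = 1 - sqrt (1 - h)]. *)
Fixpoint sqrt_iter h n : A :=
  if n is k.+1 then 2^-1 *: (h + sqrt_iter h k * sqrt_iter h k) else 0.

(** The same iteration for the scalar [h = 1]. It dominates the norms of the iterates, and of their
    increments, for every contraction [h]. *)
Fixpoint sqrt_majorant n : R :=
  if n is k.+1 then (1 + sqrt_majorant k * sqrt_majorant k) / 2 else 0.

Lemma sqrt_majorant_itv n : 0 <= sqrt_majorant n <= 1.
Proof. by elim: n => [|n /andP[? ?]] /=; [rewrite lexx ler01|nra]. Qed.

Lemma sqrt_majorantS n : sqrt_majorant n <= sqrt_majorant n.+1.
Proof. by have /andP[? ?] := sqrt_majorant_itv n => /=; nra. Qed.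

Lemma cvgn_sqrt_majorant : cvgn sqrt_majorant.
Proof.
apply: nondecreasing_is_cvgn; first exact/nondecreasing_seqP/sqrt_majorantS.
by exists 1 => _ [n _ <-]; have /andP[] := sqrt_majorant_itv n.
Qed.

Lemma sqrt_iter_comm h c n : c * h = h * c ->
  c * sqrt_iter h n = sqrt_iter h n * c.
Proof.
move=> ch; elim: n => [|n ih] /=; first by rewrite mulr0 mul0r.
rewrite -cstar_scalerAr -cstar_scalerAl mulrDr mulrDl ch.
by rewrite mulrA ih -mulrA ih mulrA.
Qed.

Lemma star_sqrt_iter h n : star h = h -> star (sqrt_iter h n) = sqrt_iter h n.
Proof.
move=> sh; elim: n => [|n ih] /=; first exact: star0.
by rewrite starZ starD starM ih sh conj_Creal// rpredV realn.
Qed.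

Lemma norm_sqrt_iter h n : `|h| <= 1 ->
  `|sqrt_iter h n| <= (sqrt_majorant n)%:C%C.
Proof.
move=> h1; elim: n => [|n ih] /=; first by rewrite normr0.
rewrite normrZ ger0_norm ?invr_ge0// rmorphM mulrC rmorphD rmorphM rmorph1.
rewrite fmorphV rmorph_nat ler_wpM2r ?invr_ge0//.
rewrite (le_trans (ler_normD _ _))// lerD// (le_trans (cstar_normrM _ _))//.
by rewrite ler_pM.
Qed.

(** Consecutive iterates [r], [r'] commute, so the next increment is [(r' - r) (r' + r) / 2]. The
    majorant obeys the same recursion, which lets the bounds multiply. *)
Lemma sqrt_iterS_dist h n : `|h| <= 1 ->
  `|sqrt_iter h n.+1 - sqrt_iter h n| <=
  (sqrt_majorant n.+1 - sqrt_majorant n)%:C%C.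
Proof.
move=> h1; elim: n => [|n ih].
  rewrite /= !mulr0 !addr0 !subr0 normrZ ger0_norm ?invr_ge0// mul1r.
  by rewrite fmorphV rmorph_nat ler_piMr ?invr_ge0.
set r := sqrt_iter h n; set r' := sqrt_iter h n.+1.
have rr' : r * r' = r' * r.
  by apply/sqrt_iter_comm/esym/sqrt_iter_comm.
have -> : sqrt_iter h n.+2 - r' = 2^-1 *: ((r' - r) * (r' + r)).
  have iterS k : sqrt_iter h k.+1 =
    2^-1 *: (h + sqrt_iter h k * sqrt_iter h k) by [].
  rewrite (iterS n.+1) {2}/r' (iterS n) -/r -/r' -scalerBr; congr (_ *: _).
  by rewrite opprD addrACA subrr add0r mulrDr !mulrBl rr' subrKA.
have -> : sqrt_majorant n.+2 - sqrt_majorant n.+1 =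
    2^-1 * ((sqrt_majorant n.+1 - sqrt_majorant n) *
            (sqrt_majorant n.+1 + sqrt_majorant n)) by rewrite /=; lra.
rewrite normrZ ger0_norm ?invr_ge0// rmorphM fmorphV rmorph_nat.
rewrite ler_wpM2l ?invr_ge0// (le_trans (cstar_normrM _ _))// rmorphM ler_pM//.
by rewrite (le_trans (ler_normD _ _))// rmorphD lerD// norm_sqrt_iter.
Qed.

Lemma cvgn_sqrt_iter h : `|h| <= 1 -> cvgn (sqrt_iter h).
Proof.
move=> h1; apply: cvgn_dominated cvgn_sqrt_majorant _ => n m /subnK <-.
elim: (m - n)%N => [|k ih]; first by rewrite !subrr normr0.
rewrite addSn -(subrKA (sqrt_iter h (k + n))) (le_trans (ler_normD _ _))//.
rewrite -(subrKA (sqrt_majorant (k + n)) (sqrt_majorant (k + n).+1)) rmorphD.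
by rewrite lerD// sqrt_iterS_dist.
Qed.

Lemma sqrt_one_minus h : star h = h -> `|h| <= 1 ->
  exists s : A, [/\ star s = s, s * s = 1 - h &
    forall c, c * h = h * c -> c * s = s * c].
Proof.
move=> sh h1; have := cvgn_sqrt_iter h1; set r := lim _ => cr.
have eq_limn (f g : nat -> A) (a b : A) : (forall n, f n = g n) ->
    f @ \oo --> a -> g @ \oo --> b -> a = b.
  by move=> /funext -> fa gb; exact: norm_cvg_unique fa gb.
have cvg_mul (f g : A -> A) : continuous f -> continuous g ->
    (fun n => f (sqrt_iter h n) * g (sqrt_iter h n)) @ \oo --> f r * g r.
  move=> cf cg; have /(_ r) := cstar_mul_continuous cf cg.
  exact: cvg_comp cr.
have cid : continuous (@id A) by move=> z; exact: cvg_id.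
have ccst (c : A) : continuous (fun _ : A => c) by move=> z; exact: cvg_cst.
(* The limit inherits the recursion as a fixed-point equation, which rearranges to
   [(1 - r)^2 = 1 - h]; hence the root [1 - r]. *)
have rE : r = 2^-1 *: (h + r * r).
  apply: (eq_limn (fun n => sqrt_iter h n.+1)) => //.
    by move: cr; rewrite -(cvg_shiftS (sqrt_iter h)).
  by apply: cvgZr; apply: cvgD (cvg_mul _ _ cid cid); exact: cvg_cst.
have sr : star r = r.
  apply: (eq_limn (fun n => star (sqrt_iter h n)) (sqrt_iter h)) => [n||//].
    exact: star_sqrt_iter.
  by have := @star_continuous _ A; move=> /(_ r); apply: cvg_comp cr.
exists (1 - r); split.
- by rewrite starB star1 sr.
- have r2 : r + r = h + r * r.
    rewrite -[r + r]mulr2n -[r *+ 2]scaler_nat {1}rE scalerA mulfV.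
      by rewrite scale1r.
    by rewrite pnatr_eq0.
  rewrite mulrBl mul1r mulrBr mulr1 opprB addrA addrAC.
  by rewrite -[1 - r - r]addrA -opprD r2 opprD addrA addrNK.
- move=> c ch; rewrite mulrBl mulrBr mulr1 mul1r; congr (_ - _).
  apply: eq_limn (cvg_mul _ _ (ccst c) cid) (cvg_mul _ _ cid (ccst c)) => n.
  exact: sqrt_iter_comm.
Qed.

End SquareRoot.

(** * Rigidity of C*-extreme points, and a bound for a quintic *)

Section Extreme.
Context {R : realType} {A : cstarAlgType R}.
Implicit Types (x y a b : A).

Lemma star_cong_unitary u x : cstar_unitary u ->
  star (star u * x * u) * (star u * x * u) = star u * (star x * x) * u.
Proof.
move=> [_ uu]; rewrite !starM starK !mulrA; congr (_ * _).
by rewrite -(mulrA (star u * star x)) uu mulr1.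
Qed.

(* With [t_i = 1 / sqrt 2], the two points [x + y] and [x - y] are unitarily
   equivalent to [x], so the parallelogram law under a trace kills [y]. *)
Lemma cstar_extreme_rigid (I : Type) (T : I -> {scalar A}) x y :
  (forall i, tracial_state (T i)) ->
  (forall b : A, (forall i, T i (star b * b) = 0) -> b = 0) ->
  cstar_extreme_point x -> `|x + y| <= 1 -> `|x - y| <= 1 -> y = 0.
Proof.
move=> Ttr Tsep [_ xext] xy1 xy2; apply: Tsep => i.
pose c : R[i] := sqrtC 2^-1.
have c0 : c != 0 by rewrite sqrtC_eq0 invr_eq0 pnatr_eq0.
have sc w : star (c *: (1 : A)) * w * (c *: (1 : A)) = 2^-1 *: w.
  rewrite -cstar_scalerAr mulr1 starZ star1 -cstar_scalerAl mul1r scalerA.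
  by rewrite conj_Creal ?ger0_real ?sqrtC_ge0 ?invr_ge0// -expr2 sqrtCK.
have halves : 2^-1 + 2^-1 = 1 :> R[i] by rewrite [RHS]splitr div1r.
pose z (j : 'I_2) := if j == 0 then x + y else x - y.
have [j|_|||u uP] := xext 2%N z (fun=> c *: (1 : A)).
- by rewrite /z; case: ifP.
- by exists (c^-1 *: (1 : A)); split; rewrite -cstar_scalerAl mul1r scalerA
    ?mulVf ?mulfV ?scale1r.
- have := sc 1; rewrite mulr1 => cc.
  by rewrite !big_ord_recl big_ord0 addr0 cc -scalerDl halves scale1r.
- rewrite !big_ord_recl big_ord0 addr0 !sc -scalerDr /z/=.
  by rewrite addrACA subrr addr0 scalerDr -scalerDl halves scale1r.
have Tz j : T i (star (z j) * z j) = T i (star x * x).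
  have [uu ->] := uP j; rewrite star_cong_unitary// (Ttr i).2 mulrA.
  by case: uu => _ ->; rewrite mul1r.
have par : star (x + y) * (x + y) + star (x - y) * (x - y) =
    (star x * x + star y * y) *+ 2.
  have addB2 (b d : A) : b + d + (b - d) = b *+ 2.
    by rewrite addrACA subrr addr0.
  rewrite starD starB !mulrDr !mulrDl !mulrN !mulNr opprK addrACA addB2.
  by rewrite (addrC (star x * y)) (addrC (- _)) addB2 -mulrnDl.
have /eqP := congr1 (T i) par.
have := Tz 0; have := Tz 1; rewrite /z/= => z1 z0.
rewrite raddfMn !raddfD /= z0 z1 -mulr2n -subr_eq0 -mulrnBl opprD addNKr.
by rewrite mulrn_eq0/= oppr_eq0 => /eqP.
Qed.

(* For [a = x^* x] this bounds [x (1 + (1 - a^2) / 4)].  The scalar function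
   [t (5 - t^2)^2 / 16] is odd and bounded by 1 on all of [-1, 1], so the
   positivity of [x^* x] is not needed; the factor [(1 - t^2)^2] of 1 minus its
   square lets that difference be written as a square. *)
Lemma norm_quintic_le1 a : star a = a -> `|a| <= 1 ->
  `|16^-1 *: (a * (5 - a ^+ 2) ^+ 2)| <= 1.
Proof.
move=> sa a1; set v := a ^+ 2; set g := _ *: _.
have sv : star v = v by rewrite star_exp sa.
have v1 : `|v| <= 1 by exact: cstar_normX_le1.
have va b : GRing.comm a b -> GRing.comm v b.
  by move=> ab; exact/commr_sym/commrX/commr_sym.
have av : GRing.comm a v by exact: commrX.
have vE : a ^+ 2 = v by [].
clearbody v.
pose k : R[i] := (16 ^+ 2)^-1.
have k0 : 0 <= k by rewrite invr_ge0 exprn_ge0.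
have kA : k *: (16 ^+ 2 : A) = 1.
  by rewrite /k -!natrX -(scaler_nat _ (1 : A)) scalerA mulVf ?scale1r//.
(* [1 - k q] is the second factor in [quintic_factorization], divided by [16^2]. Its square root
   exists since [113 + 18 + 1 <= 16^2] makes [k q] a contraction. *)
pose q := v *+ 113 - v ^+ 2 *+ 18 + v ^+ 3.
have sq : star q = q by rewrite starD starB !star_mulrn !star_exp sv.
have normMn b n : `|b| <= 1 -> `|b *+ n| <= n%:R.
  by move=> b1; rewrite normrMn lerMn2r b1 orbT.
have q1 : `|k *: q| <= 1.
  rewrite normrZ ger0_norm// ler_pdivrMl ?exprn_gt0// mulr1.
  rewrite (le_trans (ler_normD _ _))//.
  rewrite (le_trans (lerD (ler_normB _ _) (lexx _)))//.
  apply: (@le_trans _ _ (113 + 18 + 1)%N%:R).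
    rewrite (natrD _ (113 + 18)) (natrD _ 113) lerD ?cstar_normX_le1//.
    by rewrite lerD ?normMn ?cstar_normX_le1.
  by rewrite -natrX ler_nat.
have kR : (k^*)%R = k by rewrite conj_Creal// ger0_real.
have [||s [ss s2 sc]] := @sqrt_one_minus _ _ (k *: q) => //.
  by rewrite starZ sq kR.
have fa : GRing.comm a (5 - v) by apply: commrB => //; exact: commr_nat.
have scomm b : GRing.comm b v -> b * s = s * b.
  move=> bv; apply: sc; rewrite -cstar_scalerAl -cstar_scalerAr; congr (_ *: _).
  rewrite /q; apply: commrD; last exact: commrX.
  by apply: commrB; apply: commrMn => //; exact: commrX.
have vs : GRing.comm (1 - v) s.
  by apply: scomm; apply: commr_sym; apply: commrB => //; exact: commr1.
have sg : star g = g.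
  rewrite /g starZ conj_Creal ?ger0_real ?invr_ge0// starM star_exp starB.
  rewrite sv star_mulrn star1 sa; congr (_ *: _).
  by apply: commr_sym; apply: commrX.
have am : GRing.comm a ((1 - v) * s).
  by apply: commrM; [apply: commrB => //; exact: commr1|exact: scomm].
(* [(1 - v) s] is the sine that completes the cosine [g]. *)
apply: (@norm_cos_le1 _ _ g ((1 - v) * s)) => //.
- by rewrite starM starB star1 sv ss.
- rewrite /g -cstar_scalerAl -cstar_scalerAr; congr (_ *: _).
  apply/commr_sym/commrM; first exact: commr_sym.
  by apply: commrX; apply: commrB; [exact: commr_nat|exact/commr_sym/va].
- have -> : g * g = k *: (v * (5 - v) ^+ 4).
    rewrite /g -cstar_scalerAl -cstar_scalerAr scalerA -invfM -expr2.
    congr (_ *: _); rewrite -expr2 exprMn_comm; last exact: commrX.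
    by rewrite vE -exprM.
  have -> : (1 - v) * s * ((1 - v) * s) = (1 - v) ^+ 2 * (1 - k *: q).
    by rewrite -s2 -!expr2 exprMn_comm.
  have -> : 1 - k *: q = k *: (16 ^+ 2 - q) by rewrite scalerBr kA.
  rewrite -cstar_scalerAr -quintic_factorization -scalerDr.
  by rewrite addrC subrK kA.
Qed.

End Extreme.

(** * Rigid contractions are unitary when tracial states separate *)

Section Kadison.
Context {R : realType} {A : cstarAlgType R}.
Context {I : Type} {T : I -> {scalar A}}.
Context (Ttr : forall i, tracial_state (T i)).
Context (Tsep : forall b : A, (forall i, T i (star b * b) = 0) -> b = 0).
Context {x : A}.
Context (x1 : `|x| <= 1).
(** Extremality of [x] in midpoint form. *)
Context (xrigid : forall y, `|x + y| <= 1 -> `|x - y| <= 1 -> y = 0).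

Let a := star x * x.
Let p := 1 - x * star x.
Let q := 1 - star x * x.

Let sa : star a = a. Proof. by rewrite /a starM starK. Qed.
Let sp : star p = p. Proof. by rewrite /p starB star1 starM starK. Qed.
Let sq : star q = q. Proof. by rewrite /q starB star1 starM starK. Qed.

(** With [v = a^2], rigidity is applied to [y = x (1 - v) / 4]. The element [x + y = x (5 - v) / 4]
    satisfies [star (x + y) (x + y) = a (5 - v)^2 / 16], bounded by [norm_quintic_le1]; the bound on
    [x - y = x (3 + v) / 4] is the triangle inequality. *)
Lemma rigid_mul_sqr : x * a ^+ 2 = x.
Proof.
have a1 : `|a| <= 1 by rewrite norm_starM expr_le1.
pose v := a ^+ 2.
have v1 : `|v| <= 1 by exact: cstar_normX_le1.
have sv : star v = v by rewrite star_exp sa.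
have x4 : x = 4^-1 *: (x * 4).
  by rewrite mulr_natr -(scaler_nat 4 x) scalerA mulVf ?scale1r// pnatr_eq0.
have y0 : 4^-1 *: (x * (1 - v)) = 0.
  apply: xrigid.
    rewrite [X in X + _]x4 -scalerDr -mulrDr addrA natr1.
    apply: norm_le1_starM.
    have -> : star (4^-1 *: (x * (5 - v))) * (4^-1 *: (x * (5 - v))) =
        16^-1 *: (a * (5 - v) ^+ 2).
      rewrite starZ conj_Creal ?ger0_real ?invr_ge0// starM starB sv star_mulrn.
      rewrite star1 -cstar_scalerAl -cstar_scalerAr scalerA -invfM -natrM.
      congr (_ *: _); rewrite mulrA -(mulrA _ (star x)) -/a.
      have av : GRing.comm a (5 - v).
        by apply: commrB; [exact: commr_nat|exact: commrX].
      by rewrite -av -mulrA.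
    exact: norm_quintic_le1.
  rewrite [X in X - _]x4 -scalerBr -mulrBr opprB addrCA addrC.
  have -> : 4 - 1 = 3 :> A by rewrite -(natr1 3) addrK.
  rewrite cstar_scalerAr cstar_normM_le1// normrZ ger0_norm ?invr_ge0//.
  rewrite ler_pdivrMl// mulr1 (le_trans (ler_normD _ _))// -[leRHS](natr1 3).
  by rewrite lerD// normrMn lerMn2r norm1_le1 orbT.
move/eqP: y0; rewrite scaler_eq0 invr_eq0 pnatr_eq0/= mulrBr mulr1 subr_eq0.
by move/eqP.
Qed.

(** Now [a^3 = a], and the eigenvalue -1 has to be excluded. For [w = a^2 - a] one has [a w = - w],
    so [star (x w) (x w) = - w^2] has trace both nonnegative and nonpositive, whence [x w = 0]. *)
Lemma rigid_partial_isometry : x * star x * x = x.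
Proof.
have xv := rigid_mul_sqr.
have av : a * a ^+ 2 = a by rewrite /a -mulrA xv.
have vv : a ^+ 2 * a ^+ 2 = a ^+ 2 by rewrite [LHS]mulrA -[a * a * _]mulrA av.
pose w := a ^+ 2 - a.
have sw : star w = w by rewrite starB star_exp sa.
have aw : a * w = - w by rewrite mulrBr av opprB.
have : x * w = 0.
  apply: Tsep => i; apply/eqP; rewrite eq_le (Ttr i).1.1 andbT.
  rewrite starM sw mulrA -(mulrA w) -/a -mulrA aw mulrN linearN oppr_le0.
  by rewrite -[w in w * _]sw (Ttr i).1.1.
by rewrite mulrBr xv /a -mulrA => /eqP; rewrite subr_eq0 => /eqP.
Qed.

Let xx : x * star x * x = x := rigid_partial_isometry.

Let px : p * x = 0. Proof. by rewrite mulrBl mul1r xx subrr. Qed.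
Let xq : x * q = 0. Proof. by rewrite mulrBr mulr1 mulrA xx subrr. Qed.
Let pp : p * p = p.
Proof. by rewrite {2}/p mulrBr mulr1 mulrA px mul0r subr0. Qed.
Let qq : q * q = q.
Proof. by rewrite {1}/q mulrBl mul1r -mulrA xq mulr0 subr0. Qed.

(** For [z = p b q] the cross terms vanish, so [star (x + z) (x + z) = a + c] with [c = star z z]
    living under [q] and orthogonal to the projection [a = 1 - q]. With [s] a root of [1 - c^2], the
    sine [q s] completes the cosine [a + c]. *)
Lemma norm_add_corner_le1 b : `|b| <= 1 -> `|x + p * b * q| <= 1.
Proof.
move=> b1; set z := p * b * q.
have z1 : `|z| <= 1.
  by rewrite !cstar_normM_le1// norm_projection_le1.
have zq : z * q = z by rewrite -mulrA qq.
have xz : star x * z = 0.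
  by rewrite /z !mulrA -[p]sp -starM px star0 !mul0r.
have zx : star z * x = 0 by rewrite -[LHS]starK starM starK xz star0.
apply: norm_le1_starM; pose c := star z * z.
have -> : star (x + z) * (x + z) = a + c.
  by rewrite starD mulrDr !mulrDl xz zx addr0 add0r.
have sc : star c = c by rewrite starM starK.
have cq : c * q = c by rewrite -mulrA zq.
have qc : q * c = c by rewrite -[LHS]starK starM sq sc cq sc.
have c1 : `|c| <= 1 by rewrite norm_starM expr_le1.
have [||s [ss s2 scomm]] := @sqrt_one_minus _ _ (c * c).
- by rewrite starM sc.
- exact: cstar_normM_le1.
have qs : q * s = s * q by apply: scomm; rewrite mulrA qc -[RHS]mulrA cq.
have cs : c * s = s * c by apply: scomm; rewrite mulrA.
have aE : a = 1 - q by rewrite /q opprB addrC subrK.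
have aq : a * q = 0 by rewrite aE mulrBl mul1r qq subrr.
have qa : q * a = 0 by rewrite aE mulrBr mulr1 qq subrr.
have ac : a * c = 0 by rewrite -qc mulrA aq mul0r.
have ca : c * a = 0 by rewrite -cq -mulrA qa mulr0.
apply: (@norm_cos_le1 _ _ (a + c) (q * s)).
- by rewrite starD sa sc.
- by rewrite starM ss sq qs.
- by rewrite mulrDl mulrA aq mul0r add0r mulrA cq qs -mulrA mulrDr qa add0r qc.
- have -> : q * s * (q * s) = q - c * c.
    rewrite mulrA -(mulrA q) -qs mulrA qq -mulrA s2 mulrBr mulr1.
    by rewrite mulrA qc.
  have aa : a * a = a by rewrite {2}aE mulrBr mulr1 aq subr0.
  by rewrite mulrDl !mulrDr ac ca addr0 add0r aa addrACA subrr addr0 aE subrK.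
Qed.

Lemma rigid_corner b : p * b * q = 0.
Proof.
have corner c : `|c| <= 1 -> p * c * q = 0.
  move=> c1; apply: xrigid; first exact: norm_add_corner_le1.
  by rewrite -mulNr -mulrN norm_add_corner_le1// normrN.
(* Scaling reduces to contractions; the added 1 keeps the divisor nonzero when [b = 0]. *)
pose k : R[i] := (1 + `|b|)^-1.
have d0 : 0 < 1 + `|b| by rewrite ltr_pwDl.
have /eqP : p * (k *: b) * q = 0.
  have k0 : 0 < k by rewrite invr_gt0.
  apply: corner; rewrite normrZ (gtr0_norm k0) /k ler_pdivrMl// mulr1.
  by rewrite lerDr.
rewrite -cstar_scalerAr -cstar_scalerAl scaler_eq0 invr_eq0.
by rewrite gt_eqF//= => /eqP.
Qed.

(** For [d] the n-th term, traciality turns the next trace into that of [d (x star x) = d - d p].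
    The trace of [d p] is that of [p d], and [p d = 0] by [rigid_corner] at [b = star x ^+ n]. *)
Lemma trace_orbit i n : T i (star x ^+ n * q * x ^+ n) = T i q.
Proof.
elim: n => [|n ih]; first by rewrite !expr0 mul1r mulr1.
set d := star x ^+ n * q * x ^+ n in ih.
have -> : star x ^+ n.+1 * q * x ^+ n.+1 = star x * (d * x).
  by rewrite exprS exprSr /d !mulrA.
have xxE : x * star x = 1 - p by rewrite /p opprB addrC subrK.
rewrite (Ttr i).2 -mulrA xxE mulrBr mulr1 linearB /= ih (Ttr i).2.
by rewrite /d !mulrA rigid_corner mul0r linear0 subr0.
Qed.

(** Each term telescopes since [q = 1 - star x x]. *)
Lemma sum_orbit n :
  \sum_(k < n) star x ^+ k * q * x ^+ k = 1 - star x ^+ n * x ^+ n.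
Proof.
elim: n => [|n ih]; first by rewrite big_ord0 !expr0 mulr1 subrr.
rewrite big_ord_recr/= ih {1}/q mulrBr mulr1 mulrBl.
by rewrite addrA subrK exprSr exprS !mulrA.
Qed.

Lemma trace_defect i : T i q = 0.
Proof.
have q0 : 0 <= T i q by rewrite -qq -[q in q * _]sq (Ttr i).1.1.
have qn n : T i q *+ n <= 1.
  have := congr1 (T i) (sum_orbit n); rewrite linear_sum.
  under eq_bigr do rewrite /= trace_orbit.
  rewrite sumr_const card_ord => ->.
  by rewrite linearB /= (Ttr i).1.2 gerBl -star_exp (Ttr i).1.1.
(* The bound [n T(q) <= 1] moves to [R], where the Archimedean property applies. *)
have qR : T i q = (complex.Re (T i q))%:C%C by rewrite RRe_real// ger0_real.
have qnR n : complex.Re (T i q) *+ n <= 1.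
  by have := qn n; rewrite qR -rmorphMn lecR.
have : 0 <= complex.Re (T i q) by rewrite -lecR -qR.
rewrite le_eqVlt => /orP[/eqP q0'|qpos]; first by rewrite qR -q0'.
have /archi_boundP : 0 <= (complex.Re (T i q))^-1 by rewrite invr_ge0 ltW.
rewrite ltNge => /negP[]; rewrite -(ler_pM2l qpos) mulfV ?gt_eqF//.
by rewrite mulr_natr.
Qed.

Lemma rigid_unitary : cstar_unitary x.
Proof.
have q0 : q = 0 by apply: Tsep => i; rewrite sq qq trace_defect.
have p0 : p = 0.
  apply: Tsep => i; rewrite sp pp /p linearB /= (Ttr i).2.
  by rewrite -linearB trace_defect.
by split; apply/esym/eqP; rewrite -subr_eq0; apply/eqP.
Qed.

End Kadison.

(** * Tracial states on [C(Omega, A)] from points of [Omega] *)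

Section PointEvaluation.
Context {R : realType} {Omega : topologicalType}.
Context {cOmega : compact [set: Omega]} {A : cstarAlgType R}.

Definition point_trace (tau : {scalar A}) (w : Omega) (g : cfun cOmega A) :
  R[i] := tau (g w).

Lemma point_trace_is_linear tau w : scalar (point_trace tau w).
Proof. by move=> c g h; rewrite /point_trace -linearP. Qed.

HB.instance Definition _ tau w := GRing.isLinear.Build R[i] (cfun cOmega A)
  R[i] _ (point_trace tau w) (point_trace_is_linear tau w).

Lemma point_trace_tracial (tau : {scalar A}) w :
  tracial_state tau -> tracial_state (point_trace tau w).
Proof.
move=> [[pos one] tr]; split=> [|g h]; last exact: tr.
by split=> [g|]; [exact: pos|exact: one].
Qed.

End PointEvaluation.

Theorem corollary2p4 (R : realType) (Omega : topologicalType)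
    (cOmega : compact [set: Omega]) (hOmega : hausdorff_space Omega)
    (A : cstarAlgType R) (tau : {scalar A})
    (tau_tracial : tracial_state tau) (tau_faithful : faithful_state tau)
    (f : cfun cOmega A) :
  cstar_extreme_point f -> cstar_unitary f.
Proof.
move=> fext; pose T w : {scalar cfun cOmega A} := point_trace tau w.
have Ttr w : tracial_state (T w) by exact: point_trace_tracial.
have Tsep (g : cfun cOmega A) : (forall w, T w (star g * g) = 0) -> g = 0.
  (* Faithfulness of [tau] kills [g] point by point; no single faithful trace on [C(Omega, A)] has
     to be built. *)
  by move=> g0; apply: cfunP => w; apply: tau_faithful; exact: g0.
apply: (rigid_unitary Ttr Tsep); first exact: fext.1.
by move=> g; exact: (cstar_extreme_rigid Ttr Tsep fext).
Qed.
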